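(* Consider weighted scale-free percolation $\mathrm{SFP}_{W,L}$ on $\mathbb{Z}^d$ with $\lambda>0$, $\alpha>d$, $\tau>1$, $\gamma=\alpha(\tau-1)/d>2$ and $F_L(0)=0$. Then for every $x\in\mathbb{Z}^d$, $\tau_n(x)$ grows at least at order $\log n$: there is a constant $c>0$ such that almost surely $\tau_n(x)\ge c\log n$ for all sufficiently large $n$. Thus $\tau_n(x)\to\infty$ almost surely as $n\to\infty$; that is, explosion is never possible when $\gamma>2$.
   Context: Scale-free percolation model. Fix $d\ge1$, $\alpha>d$ and $\lambda>0$. Each $x\in\mathbb{Z}^d$ gets an i.i.d. vertex-weight $W_x$ distributed as $W$, where $\mathbb{P}(W\ge1)=1$ and $\mathbb{P}(W>t)=\ell(t)/t^{\tau-1}$, with $\tau>1$ and $\ell$ slowly varying at infinity. Conditionally on $(W_x)_{x\in\mathbb{Z}^d}$, edges are present independently: each pair $x,y$ with $\|x-y\|=1$ (Euclidean norm) is always connected by an edge, and each pair with $\|x-y\|>1$ is connected with probability $1-\exp\{-\lambda W_xW_y/\|x-y\|^\alpha\}$. Then every present edge $e$ is given an i.i.d. edge-weight $L_e\ge0$ distributed as $L$, independent of everything else; the resulting weighted graph is $\mathrm{SFP}_{W,L}$. Set $\gamma:=\alpha(\tau-1)/d$ and $F_L(t)=\mathbb{P}(L\le t)$. $\mathrm{d}_L(x,y)$ is the infimum over paths $\pi$ from $x$ to $y$ of $\sum_{e\in\pi}L_e$; $B_t^L(x)=\{y:\mathrm{d}_L(x,y)\le t\}$; $\tau_n(x):=\inf\{t:|B_t^L(x)|\ge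 n\}$. Explosion (of $x$) means that infinitely many vertices are reachable from $x$ within some finite $L$-distance. *)

(* Defs.v *)
From mathcomp Require Import all_boot all_order all_algebra.
From mathcomp Require Import finmap.
From mathcomp Require Import all_classical all_reals all_analysis.

Set Implicit Arguments.
Unset Strict Implicit.
Unset Printing Implicit Defensive.

Import Order.TTheory GRing.Theory Num.Theory.
Import numFieldNormedType.Exports.

Local Open Scope classical_set_scope.
Local Open Scope ring_scope.

Section probability_notions.
Context {R : realType}.

Definition slowly_varying (ell : R -> R) : Prop :=
  [/\ measurable_fun (`]0, +oo[ : set R) ell,
      (forall t, 0 < t -> 0 < ell t)
    & forall a, 0 < a -> ell (a * t) / ell t @[t --> +oo] --> (1 : R)].

Context {disp : measure_display} {T : measurableType disp}.
Variable P : probability T R.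

Definition same_law (dispQ : measure_display) (TQ : measurableType dispQ)
    (Q : probability TQ R) (X : {RV P >-> R}) (Y : {RV Q >-> R}) : Prop :=
  forall B : set R, measurable B -> distribution P X B = distribution Q Y B.

(* Families are indexed by a subset D of I; members outside D are junk. *)
Definition mutually_independent (I : choiceType) (D : set I)
    (X : I -> {RV P >-> R}) : Prop :=
  forall (s : seq I) (B : I -> set R),
    uniq s -> (forall i, i \in s -> D i) -> (forall i, measurable (B i)) ->
    P (\bigcap_(i in [set` s]) (X i @^-1` B i)) =
    (\prod_(i <- s) P (X i @^-1` B i))%E.

Definition preimage_events (I : choiceType) (D : set I)
    (X : I -> {RV P >-> R}) : set (set T) :=
  [set A | exists i (B : set R), [/\ D i, measurable B & A = X i @^-1` B]].

Definition independent_classes (F G : set (set T)) : Prop :=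
  forall A B, F A -> G B -> P (A `&` B) = (P A * P B)%E.

(* g is a version of the conditional probability P(B | G), for G a
   sub-sigma-algebra. *)
Definition is_cond_prob (G : set (set T)) (B : set T) (g : T -> R) : Prop :=
  [/\ forall Y : set R, measurable Y -> G (g @^-1` Y),
      P.-integrable setT (EFin \o g)
    & forall A, G A -> (\int[P]_(w in A) (g w)%:E = P (A `&` B))%E].

End probability_notions.

Section scale_free_percolation.
Context {R : realType} {d : nat}.
Implicit Types x y : 'rV[int]_d.

(* The library norm on row vectors is the sup norm, hence this definition. *)
Definition enorm x : R := Num.sqrt (\sum_(i < d) (x 0 i)%:~R ^+ 2).

(* An edge {x, y} is encoded as the two-element finite set [fset x; y]. *)
Definition vertex_pair : set {fset 'rV[int]_d} := [set e | #|` e| = 2%N].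

Definition conn_prob (alpha lambda : R) x y (wx wy : R) : R :=
  if enorm (x - y) == 1 then 1
  else 1 - expR (- (lambda * wx * wy / enorm (x - y) `^ alpha)).

Section model.
Context {disp : measure_display} {T : measurableType disp}.
Variable P : probability T R.
Variables (W : 'rV[int]_d -> {RV P >-> R})
          (E : {fset 'rV[int]_d} -> set T)
          (L : {fset 'rV[int]_d} -> {RV P >-> R}).

Definition sigma_W : set (set T) := <<s preimage_events setT W >>.

Definition sigma_WE : set (set T) :=
  <<s preimage_events setT W `|` [set A | exists2 e, vertex_pair e & A = E e] >>.

Definition sigma_L : set (set T) := <<s preimage_events vertex_pair L >>.

(* W x is the weight of the vertex x, E e is the event that the edge e is
   present, and L e is the weight of e; L is defined on all vertex pairs but only
   its values on present edges enter the distance. The field sfp_edges says that,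
   given sigma(W), the events E {x, y} are independent with conditional
   probabilities conn_prob; the list s enumerates distinct unordered pairs. *)
Record is_SFP (alpha lambda : R)
    (dispQ : measure_display) (TQ : measurableType dispQ)
    (Q : probability TQ R) (W0 L0 : {RV Q >-> R}) : Prop := {
  sfp_vertex_weight_law : forall x, same_law (W x) W0 ;
  sfp_vertex_weight_indep : mutually_independent setT W ;
  sfp_edge_measurable : forall e, vertex_pair e -> measurable (E e) ;
  sfp_edges : forall s : seq ('rV[int]_d * 'rV[int]_d),
    (forall p, p \in s -> p.1 != p.2) ->
    uniq [seq [fset p.1; p.2]%fset | p <- s] ->
    is_cond_prob P sigma_W
      (\bigcap_(p in [set` s]) E [fset p.1; p.2]%fset)
      (fun w => \prod_(p <- s)
                  conn_prob alpha lambda p.1 p.2 (W p.1 w) (W p.2 w)) ;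
  sfp_edge_weight_law : forall e, vertex_pair e -> same_law (L e) L0 ;
  sfp_edge_weight_indep : mutually_independent vertex_pair L ;
  sfp_edge_weight_indep_graph : independent_classes P sigma_L sigma_WE }.

Definition adjacent (w : T) x y : bool :=
  (x != y) && `[< E [fset x; y]%fset w >].

(* The path visits x followed by the vertices listed in p. *)
Definition is_path (w : T) x y (p : seq 'rV[int]_d) : Prop :=
  [/\ path (adjacent w) x p, last x p = y & uniq (x :: p)].

Definition path_weight (w : T) x (p : seq 'rV[int]_d) : R :=
  \sum_(e <- pairmap (fun u v => [fset u; v]%fset) x p) L e w.

Definition dist_L (w : T) x y : \bar R :=
  ereal_inf [set (path_weight w x p)%:E | p in [set p | is_path w x y p]].

Definition ball_L (w : T) x (t : R) : set 'rV[int]_d :=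
  [set y | (dist_L w x y <= t%:E)%E].

(* `I_n #<= B says that the possibly infinite set B has at least n elements. *)
Definition tau_n (w : T) x (n : nat) : \bar R :=
  ereal_inf [set t%:E | t in [set t : R | (`I_n #<= ball_L w x t)%card]].

Definition explosive (w : T) x : Prop :=
  exists t : R, infinite_set (ball_L w x t).

End model.
End scale_free_percolation.

(* Main.v *)
Require Import Defs.
From mathcomp Require Import all_boot all_order all_algebra.
From mathcomp Require Import finmap.
From mathcomp Require Import all_classical all_reals all_analysis.
From mathcomp Require Import measurable_realfun.
From mathcomp Require Import ring lra.
Import Order.TTheory GRing.Theory Num.Theory.
Import numFieldNormedType.Exports.
Local Open Scope classical_set_scope.
Local Open Scope ring_scope.

(**
Fix s with d/alpha < s <= 1 and 2 s < tau - 1, which is possible since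
gamma > 2.  As 1 - exp(-u) <= u^s, the probability of an edge {y, z} given the
weights is at most a constant times W_y^s W_z^s |y - z|^(-alpha s); the weights
are decoupled and |z|^(-alpha s) is summable over the lattice.  A
self-avoiding path visits distinct vertices and E W^(2s) is finite, so the
expected number of present self-avoiding paths of length k from x is at most
C^(k+1).  Since F_L(0) = 0, a large kap makes E exp(-kap L) so small that

  S = sum over present self-avoiding paths p from x of exp(-kap * weight of p)

has finite expectation.  Almost surely S is finite, and then
|B_t(x)| <= S exp(kap (t + 1)) for all t at once.
*)

Set Implicit Arguments.
Unset Strict Implicit.
Unset Printing Implicit Defensive.

(** * Expectations of products of independent variables *)

Section independence.
Context {R : realType} {disp : measure_display} {T : measurableType disp}.
Variable P : probability T R.
Variables (I : choiceType) (X : I -> {RV P >-> R}).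

(** The event [G] takes part so that an induction can absorb the coordinates into it one at a
    time. *)
Definition indep_event (G : set T) (s : seq I) : Prop :=
  forall B : I -> set R, (forall i, measurable (B i)) ->
    P (G `&` \bigcap_(i in [set` s]) (X i @^-1` B i)) =
    (P G * \prod_(i <- s) P (X i @^-1` B i))%E.

Lemma measurable_RV_preimage (i : I) (B : set R) :
  measurable B -> measurable (X i @^-1` B).
Proof.
by move=> mB; rewrite -[X in measurable X]setTI; exact: measurable_funP.
Qed.

Lemma indep_event_cons (G : set T) (i : I) (s : seq I) (A : set R) :
  measurable A -> uniq (i :: s) -> indep_event G (i :: s) ->
  P (G `&` X i @^-1` A) = (P G * P (X i @^-1` A))%E /\
  indep_event (G `&` X i @^-1` A) s.
Proof.
move=> mA /= /andP[iNs us] indG.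
have key (B : I -> set R) : (forall j, measurable (B j)) ->
    P (G `&` X i @^-1` A `&` \bigcap_(j in [set` s]) (X j @^-1` B j)) =
    (P G * P (X i @^-1` A) * \prod_(j <- s) P (X j @^-1` B j))%E.
  (* As [i] does not occur in [s], changing the family at [i] leaves the factors over [s]
     untouched. *)
  move=> mB; have {indG} := indG (fun j => if j == i then A else B j).
  rewrite !bigcap_seq !big_cons eqxx muleA setIA.
  rewrite (@eq_big_seq _ _ _ _ s _ (fun j => X j @^-1` B j)); last first.
    by move=> j js; case: eqP => // ji; rewrite -ji js in iNs.
  rewrite (@eq_big_seq _ _ _ _ s _ (fun j => P (X j @^-1` B j))); last first.
    by move=> j js; case: eqP => // ji; rewrite -ji js in iNs.
  by apply=> j; case: ifP.
have PA : P (G `&` X i @^-1` A) = (P G * P (X i @^-1` A))%E.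
  have := key (fun=> setT) (fun=> measurableT).
  rewrite big1 ?mule1; last by move=> j _; rewrite preimage_setT probability_setT.
  by rewrite bigcapT ?setIT// => j _; rewrite preimage_setT.
by split=> // B mB; rewrite key// PA.
Qed.

(* Covering [f] by layers [c j] on [B j] reduces the factorisation of the
   expectation to that of probabilities. *)
Lemma integral_prod_indep_le (f : R -> R) (c : nat -> R) (B : nat -> set R)
    (m : R) (G : set T) (s : seq I) :
  (forall r, 0 <= f r) -> measurable_fun setT f ->
  (forall j, 0 <= c j) -> (forall j, measurable (B j)) -> 0 <= m ->
  (forall r, exists2 j, B j r & f r <= c j) ->
  (forall i, i \in s ->
     (\sum_(0 <= j <oo) (c j)%:E * P (X i @^-1` B j) <= m%:E)%E) ->
  uniq s -> measurable G -> indep_event G s ->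
  (\int[P]_(w in G) (\prod_(i <- s) f (X i w))%:E <= P G * (m ^+ size s)%:E)%E.
Proof.
move=> f0 mf c0 mB m0 cover.
have fB r : ((f r)%:E <= \sum_(0 <= j <oo) (c j * \1_(B j) r)%:E)%E.
  have [j Bj fj] := cover r.
  have cB0 k : (0 <= (c k * \1_(B k) r)%:E)%E by rewrite lee_fin mulr_ge0.
  apply: le_trans (nneseries_lim_ge j.+1 (fun k _ _ => cB0 k)).
  rewrite big_nat_recr//= indicE mem_set// mulr1.
  by rewrite -[leLHS]add0e leeD ?sume_ge0// lee_fin.
elim: s G => [|i s IH] G sm us mG indG.
  under eq_integral do rewrite big_nil.
  by rewrite integral_cst// mul1e expr0 mule1.
have mprod (D : set T) s' : measurable_fun D (fun w => \prod_(i <- s') f (X i w)).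
  apply: measurable_prod => k _; apply: measurable_funTS.
  by apply: measurableT_comp => //; exact: measurable_funP.
have p0 s' w : 0 <= \prod_(i <- s') f (X i w) by apply: prodr_ge0.
pose F (j : nat) (w : T) : \bar R :=
  ((c j * \1_(X i @^-1` B j) w) * \prod_(i <- s) f (X i w))%:E.
have F0 j w : (0 <= F j w)%E by rewrite lee_fin !mulr_ge0.
have mF j : measurable_fun G (F j).
  apply/measurable_EFinP/measurable_funM => //; apply: measurable_funM => //.
  by apply: measurable_indic; exact: measurable_RV_preimage.
have usN : uniq s by case/andP: us.
apply: (@le_trans _ _ (\int[P]_(w in G) \sum_(0 <= j <oo) F j w)%E).
  apply: ge0_le_integral => //.
  - by move=> w _; rewrite lee_fin p0.
  - exact/measurable_EFinP.
  - exact: ge0_emeasurable_sum.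
  move=> w _; rewrite /F big_cons mulrC EFinM.
  under eq_eseriesr do rewrite mulrC EFinM.
  rewrite nneseriesZl; last by move=> j _; rewrite lee_fin mulr_ge0.
  by apply: lee_pmul => //; rewrite lee_fin ?p0.
rewrite integral_nneseries//.
(* On layer [j] of the coordinate [i], the induction hypothesis applies to [G] intersected with that
   layer. *)
have step j : (\int[P]_(w in G) F j w <=
    (P G * (m ^+ size s)%:E) * ((c j)%:E * P (X i @^-1` B j)))%E.
  have mXB : measurable (X i @^-1` B j) by exact: measurable_RV_preimage.
  have [PG iG] := indep_event_cons (mB j) us indG.
  have -> : (\int[P]_(w in G) F j w = (c j)%:E *
      \int[P]_(w in G `&` X i @^-1` B j) (\prod_(i <- s) f (X i w))%:E)%E.
    rewrite integral_mkcondr.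
    rewrite -ge0_integralZl//; last 3 first.
    - apply: (measurable_restrict _ mXB mG).1; exact/measurable_EFinP.
    - by move=> w _; rewrite /patch; case: ifP => // _; rewrite lee_fin p0.
    - by rewrite lee_fin.
    apply: eq_integral => w _; rewrite /F /patch indicE.
    by case: ifP => _; rewrite ?mulr1 ?mulr0 ?mul0r ?mule0 ?EFinM.
  rewrite muleCA; apply: lee_wpmul2l; first by rewrite lee_fin.
  rewrite muleAC -PG; apply: IH => //; last exact: measurableI.
  by move=> k ks; apply: sm; rewrite inE ks orbT.
apply: (@le_trans _ _ (\sum_(0 <= j <oo)
    (P G * (m ^+ size s)%:E) * ((c j)%:E * P (X i @^-1` B j)))%E).
  by apply: lee_nneseries => // j _ _; exact: integral_ge0.
have PGE : P G \is a fin_num by exact: fin_num_measure.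
rewrite -(fineK PGE) -EFinM nneseriesZl; last first.
  by move=> j _; rewrite mule_ge0// lee_fin.
rewrite /= exprSr -[leRHS]EFinM mulrA [leRHS]EFinM; apply: lee_wpmul2l.
  by rewrite lee_fin mulr_ge0 ?exprn_ge0// fine_ge0.
by apply: sm; rewrite mem_head.
Qed.
End independence.

(** * Lattice sums *)

Lemma ler_sum_uniq_subset (R : numDomainType) (I : eqType) (F : I -> R)
    (s t : seq I) :
  (forall i, 0 <= F i) -> uniq s -> {subset s <= t} ->
  \sum_(i <- s) F i <= \sum_(i <- t) F i.
Proof.
move=> F0; elim: s t => [|i s IH] t /=.
  by move=> _ _; rewrite big_nil sumr_ge0.
move=> /andP[iNs us] st; have it : i \in t by apply: st; rewrite mem_head.
rewrite big_cons (perm_big _ (perm_to_rem it)) big_cons/= lerD2l; apply: IH => //.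
move=> j js; have := st j; rewrite inE js orbT => /(_ isT).
rewrite (perm_mem (perm_to_rem it)) inE => /orP[/eqP ji|//].
by rewrite -ji js in iNs.
Qed.

Section real_bounds.
Context {R : realType}.

(** For [u >= 1] the right-hand side is at least 1; for [u < 1], 1 - exp(-u) <= u <= u^s. *)
Lemma one_sub_expN_le_powR (u s : R) :
  0 <= u -> 0 < s -> s <= 1 -> 1 - expR (- u) <= u `^ s.
Proof.
move=> u0 s0 s1; have [u1|u1] := leP 1 u.
  apply: (@le_trans _ _ 1); first by rewrite gerBl expR_ge0.
  by rewrite -[leLHS](powRr0 u) ler_powR// ltW.
move: u0; rewrite le_eqVlt => /predU1P[<-|u0].
  by rewrite oppr0 expR0 subrr powR_ge0.
apply: (@le_trans _ _ u); first by have := expR_ge1Dx (- u); lra.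
by apply: ger1_powR => //; rewrite u0 ltW.
Qed.

(** Discrete form of the integral comparison, with a telescoping right-hand side. For b = a + 1, the
    bounds ln(b/a) >= 1/b and exp v >= 1 + v give a^(-delta) >= b^(-delta) (1 + delta/b). *)
Lemma powR_step_le (delta : R) (n : nat) : 0 < delta ->
  n.+2%:R `^ (- (1 + delta)) <=
  (1 + delta) / delta * (n.+1%:R `^ (- delta) - n.+2%:R `^ (- delta)) :> R.
Proof.
move=> d0; set a : R := n.+1%:R; set b : R := n.+2%:R.
have a0 : 0 < a by rewrite ltr0n.
have ab : b = a + 1 by rewrite /a /b natr1.
clearbody a b.
have b0 : 0 < b by lra.
have ba : b^-1 <= ln (b / a).
  have ab0 : 0 < a / b by rewrite divr_gt0.
  rewrite -[b / a]invf_div lnV ?posrE// lerNr.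
  have := @le_ln1Dx R (- b^-1); rewrite ltrN2 invf_lt1//.
  have -> : 1 - b^-1 = a / b by rewrite ab; field; apply/eqP; lra.
  by apply; lra.
have eab : a `^ (- delta) = b `^ (- delta) * expR (delta * ln (b / a)).
  rewrite /powR !gt_eqF// -expRD; congr expR.
  by rewrite ln_div ?posrE//; ring.
have lb : a `^ (- delta) >= b `^ (- delta) * (1 + delta / b).
  rewrite eab ler_wpM2l ?powR_ge0// (le_trans _ (expR_ge1Dx _))//.
  by rewrite lerD2l ler_wpM2l// ltW.
rewrite opprD powRD; last by rewrite (gt_eqF b0) implybT.
rewrite powR_inv1 ?(ltW b0)//.
apply: (@le_trans _ _ ((1 + delta) / delta * (b `^ (- delta) * (delta / b)))).
  have -> : (1 + delta) / delta * (b `^ (- delta) * (delta / b)) =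
      (1 + delta) * (b^-1 * b `^ (- delta)).
    by field; rewrite !gt_eqF.
  by rewrite ler_peMl ?mulr_ge0 ?invr_ge0 ?powR_ge0 ?(ltW b0)//; lra.
rewrite ler_wpM2l ?divr_ge0 ?(ltW d0)//; first lra.
by rewrite lerBrDl -{1}[b `^ _]mulr1 -mulrDr.
Qed.

Lemma riemann_sum_bounded (beta : R) : 1 < beta ->
  exists2 A : R, 0 < A & forall N, \sum_(n < N) n.+1%:R `^ (- beta) <= A.
Proof.
move=> b1; pose delta := beta - 1; have d0 : 0 < delta by rewrite subr_gt0.
have bE : beta = 1 + delta by rewrite /delta addrC subrK.
exists (1 + (1 + delta) / delta) => [|N].
  by rewrite addr_gt0// divr_gt0//; lra.
have key M : \sum_(n < M.+1) n.+1%:R `^ (- beta) <=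
    1 + (1 + delta) / delta * (1 - M.+1%:R `^ (- delta)) :> R.
  elim: M => [|M IH].
    by rewrite big_ord1 !powR1 subrr mulr0 addr0.
  rewrite big_ord_recr/=; apply: le_trans (lerD IH _) _.
    by rewrite bE; exact: powR_step_le.
  by rewrite -addrA lerD2l -mulrDr ler_wpM2l ?divr_ge0 ?(ltW d0)//; lra.
case: N => [|N]; first by rewrite big_ord0 addr_ge0// divr_ge0//; lra.
apply: le_trans (key N) _; rewrite lerD2l ler_piMr//.
  by rewrite divr_ge0 ?(ltW d0)//; lra.
Qed.

(** The product form lets lattice sums split into one-dimensional ones; the shift by one gives a
    zero coordinate the factor 1. *)
Definition lattice_kernel (d : nat) (beta : R) (z : 'rV[int]_d) : R :=
  \prod_(i < d) (absz (z 0 i)).+1%:R `^ (- beta).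

Lemma lattice_kernel_ge0 (d : nat) (beta : R) (z : 'rV[int]_d) :
  0 <= lattice_kernel beta z.
Proof. by apply: prodr_ge0 => i _; exact: powR_ge0. Qed.

(** After reflection the finite set lies in a box, over which the sum is the [d]-th power of a
    one-dimensional sum; each sign contributes at most [A] to the latter. *)
Lemma lattice_sum_bounded (d : nat) (beta : R) : 1 < beta ->
  exists2 A : R, 0 < A & forall (V : seq 'rV[int]_d) (x : 'rV[int]_d), uniq V ->
    \sum_(y <- V) lattice_kernel beta (x - y) <= A.
Proof.
move=> /riemann_sum_bounded[A A0 AN]; exists ((A + A) ^+ d).
  by rewrite exprn_gt0// addr_gt0.
move=> V x uV.
pose a (c : int) : R := (absz c).+1%:R `^ (- beta).
rewrite -(big_map (fun y => x - y) predT (lattice_kernel beta)).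
have {uV} : uniq [seq x - y | y <- V].
  by rewrite map_inj_uniq// => y z /addrI/oppr_inj.
move: [seq _ | _ <- _] => {V} V uV.
pose N := (\max_(z <- V) \max_(i < d) absz (z ord0 i))%N.+1.
(* Coordinates are coded by sign and modulus. Zero has two codes, which can only increase the sum
   over the box. *)
pose dec (p : bool * 'I_N) : int := if p.1 then Posz p.2 else - Posz p.2.
pose g (phi : {ffun 'I_d -> bool * 'I_N}) : 'rV[int]_d := \row_i dec (phi i).
have -> : (A + A) ^+ d = \prod_(i < d) (A + A) by rewrite prodr_const card_ord.
apply: (@le_trans _ _ (\sum_(z <-
    [seq g phi | phi <- enum {: {ffun 'I_d -> bool * 'I_N}}])
      lattice_kernel beta z)).
  apply: ler_sum_uniq_subset => // [z|z zV]; first exact: lattice_kernel_ge0.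
  apply/mapP.
  have zN i : (absz (z ord0 i) < N)%N.
    rewrite ltnS; apply: (@leq_trans (\max_(j < d) absz (z ord0 j))%N).
      exact: (leq_bigmax (F := fun j => absz (z ord0 j))).
    exact: (leq_bigmax_seq (F := fun y : 'rV[int]_d => \max_(j < d) absz (y ord0 j))%N).
  exists [ffun i => (0 <= z 0 i, Ordinal (zN i))]; first by rewrite mem_enum.
  apply/rowP => i; rewrite mxE ffunE /dec/=; case: ifPn => z0.
    by rewrite gez0_abs.
  by rewrite ltz0_abs ?opprK// ltNge.
rewrite big_map big_enum/=.
rewrite (eq_bigr (fun phi : {ffun 'I_d -> bool * 'I_N} =>
    \prod_(i < d) a (dec (phi i)))); last first.
  by move=> phi _; apply: eq_bigr => i _; rewrite mxE.
rewrite -(bigA_distr_bigA (fun _ p => a (dec p))).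
apply: ler_prod => i _; rewrite sumr_ge0/=; last by move=> *; exact: powR_ge0.
rewrite -(pair_bigA _ (fun b n => a (dec (b, n))))/= big_bool/=.
have aN j : a (dec (false, j)) = a (dec (true, j)) by rewrite /a abszN.
by apply: lerD; [exact: AN|under eq_bigr do rewrite aN; exact: AN].
Qed.

End real_bounds.

(** * Decoupling the connection probability *)

Section conn.
Context {R : realType} {d : nat}.
Implicit Types x y z : 'rV[int]_d.

Lemma norm_coord_le_enorm z (i : 'I_d) : (absz (z 0 i))%:R <= enorm z :> R.
Proof.
rewrite /enorm -(@ler_pXn2r _ 2)// ?nnegrE ?sqrtr_ge0//.
rewrite sqr_sqrtr; last by apply: sumr_ge0 => j _; exact: sqr_ge0.
rewrite (bigD1 i)//= -[leLHS]addr0 lerD//; last first.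
  by apply: sumr_ge0 => j _; exact: sqr_ge0.
by rewrite natr_absz intr_norm real_normK// num_real.
Qed.

Lemma enorm_ge1 z : z != 0 -> 1 <= enorm z :> R.
Proof.
move=> z0; have [i zi] : exists i, z 0 i != 0.
  apply/existsP; apply: contraNT z0; rewrite negb_exists => /forallP z0.
  by apply/eqP/rowP => i; rewrite mxE; apply/eqP; have := z0 i; rewrite negbK.
apply: le_trans (norm_coord_le_enorm z i).
by rewrite ler1n lt0n absz_eq0.
Qed.

(** Each coordinate satisfies |z_i| + 1 <= 2 |z|, because a nonzero lattice point has norm at least
    1. *)
Lemma enorm_powR_le_kernel (beta : R) z : 0 < beta -> z != 0 ->
  (2 * enorm z) `^ (- (beta * d%:R)) <= lattice_kernel beta z.
Proof.
move=> b0 z0; have z1 := enorm_ge1 z0.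
have e0 : 0 < 2 * enorm z :> R by rewrite mulr_gt0// (lt_le_trans ltr01).
rewrite -mulNr powRrM powR_mulrn ?powR_ge0// -[in X in _ ^+ X](card_ord d).
rewrite -prodr_const; apply: ler_prod => i _; rewrite powR_ge0/= !powRN.
have n0 : 0 < (absz (z 0 i)).+1%:R :> R by rewrite ltr0n.
rewrite lef_pV2 ?posrE ?powR_gt0//.
apply: ge0_ler_powR; rewrite ?nnegrE ?(ltW b0) ?(ltW n0) ?(ltW e0)//.
by rewrite -natr1 mulrDl mul1r lerD// norm_coord_le_enorm.
Qed.

(** The bound separates the positions from the weights and the two weights from each other.
    Truncation below at 1 makes it valid for all real weights; 2^alpha pays for the 2 in
    [enorm_powR_le_kernel]. *)
Lemma conn_prob_le (alpha lambda s beta : R) x y (wx wy : R) :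
  0 < lambda -> 0 < beta -> 0 < s -> s <= 1 -> alpha * s = beta * d%:R ->
  x != y ->
  conn_prob alpha lambda x y wx wy <=
  (2 `^ alpha * (1 + lambda)) `^ s * lattice_kernel beta (x - y) *
  (Num.max 1 `|wx| `^ s * Num.max 1 `|wy| `^ s).
Proof.
move=> l0 b0 s0 s1 sE xy; set r : R := enorm (x - y).
have r1 : 1 <= r by apply: enorm_ge1; rewrite subr_eq0.
have r0 : 0 < r by apply: lt_le_trans r1.
set vx := Num.max 1 `|wx|; set vy := Num.max 1 `|wy|.
have vx1 : 1 <= vx by rewrite le_max lexx.
have vy1 : 1 <= vy by rewrite le_max lexx.
have vxy1 : 1 <= vx * vy by rewrite -[leLHS]mulr1 ler_pM.
have vxy0 : 0 <= vx * vy by apply: le_trans vxy1.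
have l10 : 0 <= 1 + lambda by lra.
have ra0 : 0 < r `^ alpha by exact: powR_gt0.
(* [U] dominates the exponent in [conn_prob] and is at least 1 when [r = 1], so that [U ^ s] also
   covers the edges that are always present. *)
pose U := (1 + lambda) * (vx * vy) / r `^ alpha.
have U0 : 0 <= U by rewrite divr_ge0 ?(ltW ra0)// mulr_ge0.
apply: (@le_trans _ _ (U `^ s)).
  rewrite /conn_prob -/r; case: ifPn => [/eqP r1E|_].
    rewrite /U r1E powR1 divr1 -[leLHS](powRr0 ((1 + lambda) * (vx * vy))).
    rewrite ler_powR ?(ltW s0)// -[leLHS]mulr1 ler_pM//; lra.
  apply: le_trans (one_sub_expN_le_powR U0 s0 s1).
  rewrite lerD2l lerN2 ler_expR lerN2 ler_pM2r ?invr_gt0//.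
  rewrite -mulrA; apply: (@le_trans _ _ (lambda * (vx * vy))).
    rewrite ler_pM2l// (le_trans (ler_norm _))// normrM ler_pM//.
      by rewrite le_max lexx orbT.
    by rewrite le_max lexx orbT.
  by rewrite ler_wpM2r//; lra.
have -> : U `^ s = (2 `^ alpha * (1 + lambda)) `^ s *
    (2 * r) `^ (- (beta * d%:R)) * (vx `^ s * vy `^ s).
  rewrite /U !powRM ?invr_ge0 ?powR_ge0 ?mulr_ge0 ?(ltW ra0) ?(ltW r0)//; try lra.
  rewrite -sE -!powRN -!powRrM mulNr.
  have -> : 2 `^ (alpha * s) * (1 + lambda) `^ s * (2 `^ (- (alpha * s)) *
     r `^ (- (alpha * s))) * (vx `^ s * vy `^ s) =
     (2 `^ (alpha * s) * 2 `^ (- (alpha * s))) * ((1 + lambda) `^ s *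
     (vx `^ s * vy `^ s) * r `^ (- (alpha * s))) by ring.
  by rewrite [2 `^ (- _)]powRN mulfV ?gt_eqF ?powR_gt0// mul1r.
rewrite ler_wpM2r ?mulr_ge0 ?powR_ge0// ler_wpM2l ?powR_ge0//.
by apply: enorm_powR_le_kernel => //; rewrite subr_eq0.
Qed.

End conn.

(** * Moments of vertex weights *)

Section layers.
Context {R : realType} {disp : measure_display} {T : measurableType disp}.
Variable P : probability T R.

(* Implies that [f (X w)] has expectation at most [m]; as it only involves the
   law of [X], it transfers to all copies of [X]. *)
Definition layered_bound (X : {RV P >-> R}) (f : R -> R) (m : R) : Prop :=
  exists (c : nat -> R) (B : nat -> set R),
  [/\ forall j, 0 <= c j, forall j, measurable (B j),
      forall r, exists2 j, B j r & f r <= c j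
    & (\sum_(0 <= j <oo) (c j)%:E * distribution P X (B j) <= m%:E)%E].

Lemma nneseries_le_ub (u : nat -> \bar R) (M : \bar R) :
  (forall j, (0 <= u j)%E) -> (forall n, (\sum_(0 <= j < n) u j <= M)%E) ->
  (\sum_(0 <= j <oo) u j <= M)%E.
Proof.
move=> u0 uM; apply: lime_le; last exact: nearW.
by apply: is_cvg_nneseries => j _ _; exact: u0.
Qed.

(** By slow variation, doubling a large t multiplies the tail by about 2^(1 - tau), so dyadic layers
    contribute a geometric series when r < tau - 1. *)
Lemma powR_moment_layered_bound (W0 : {RV P >-> R}) (ell : R -> R) (tau r : R) :
  P [set q | 1 <= W0 q] = 1%E -> slowly_varying ell ->
  (forall t : R, 0 < t -> ccdf W0 t = (ell t / t `^ (tau - 1))%:E) ->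
  0 < r -> r < tau - 1 ->
  exists2 m : R, 0 < m &
    layered_bound W0 (fun w => Num.max 1 `|w| `^ r) m.
Proof.
move=> W1 [mell ell0 sv] tail r0 rtau.
pose h t : R := ell t / t `^ (tau - 1).
have h0 t : 0 < t -> 0 < h t by move=> t0; rewrite divr_gt0 ?ell0 ?powR_gt0.
(* The limit of 2^r h(2t) / h(t); [k] lies halfway between it and 1, which leaves room for the
   convergence. *)
pose kap : R := 2 `^ (r - (tau - 1)).
have kap0 : 0 < kap by rewrite powR_gt0.
have kap1 : kap < 1.
  rewrite /kap /powR pnatr_eq0/= expR_lt1 nmulr_rlt0 ?subr_lt0//.
  by rewrite ln_gt0// ltr1n.
pose k := (1 + kap) / 2.
have k0 : 0 <= k by rewrite /k; lra.
have k1 : k < 1 by rewrite /k; lra.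
have kk : 1 < k / kap by rewrite ltr_pdivlMr//; rewrite /k; lra.
have [t0 t01 decay] : exists2 t0 : R, 1 <= t0 &
    forall t, t0 <= t -> 2 `^ r * h (2 * t) <= k * h t.
  have /cvgr_lt/(_ _ kk) := sv 2 (ltr0Sn _ 1).
  case=> M [_ MP]; exists (Num.max 1 (M + 1)); first by rewrite le_max lexx.
  move=> t; rewrite ge_max => /andP[t1 Mt].
  have tgt0 : 0 < t by apply: lt_le_trans t1.
  have {}MP : ell (2 * t) / ell t < k / kap by apply: MP; lra.
  have e0 := ell0 _ tgt0.
  rewrite ltr_pdivrMr// in MP.
  rewrite /h powRM// ?(ltW tgt0)//.
  have -> : 2 `^ r * (ell (2 * t) / (2 `^ (tau - 1) * t `^ (tau - 1))) =
    kap * (ell (2 * t) / t `^ (tau - 1)).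
    rewrite /kap powRB; last by rewrite pnatr_eq0 implybT.
    by field; rewrite !gt_eqF ?powR_gt0.
  rewrite [leRHS](_ : _ = kap * (k / kap * ell t / t `^ (tau - 1))); last first.
    by field; rewrite !gt_eqF ?powR_gt0.
  by rewrite ler_pM2l// ler_pM2r ?invr_gt0 ?powR_gt0// ltW.
have t0gt0 : 0 < t0 by apply: lt_le_trans t01.
pose b j : R := 2 ^+ j * t0.
have bt0 j : t0 <= b j by rewrite ler_peMl ?(ltW t0gt0)// exprn_ege1// ler1n.
have b0 j : 0 < b j by apply: lt_le_trans (bt0 j).
have bS j : b j.+1 = 2 * b j by rewrite /b exprS mulrA.
have bdecay j : (2 `^ r) ^+ j * h (b j) <= k ^+ j * h t0.
  elim: j => [|j IH]; first by rewrite /b !expr0 !mul1r.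
  rewrite bS exprSr -mulrA; apply: le_trans (ler_wpM2l _ (decay _ (bt0 j))) _.
    by rewrite exprn_ge0// powR_ge0.
  by rewrite mulrCA exprS -mulrA ler_wpM2l.
(* Layer 0 is the whole line and takes care of |w| <= t0; layer [j.+1] takes care of b_j < |w| <=
   b_(j+1). *)
pose c j : R := if j is j'.+1 then b j'.+1 `^ r else t0 `^ r.
pose B j : set R := if j is j'.+1 then [set w | b j' < `|w|] else setT.
have c0 j : 0 <= c j by case: j => [|j]; exact: powR_ge0.
have mB j : measurable (B j).
  case: j => [|j]; first exact: measurableT.
  rewrite /B (_ : [set w | _] = Num.norm @^-1` `]b j, +oo[%classic).
    by rewrite -[X in measurable X]setTI; exact: measurable_funP.
  by apply/seteqP; split=> w /=; rewrite in_itv/= andbT.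
(* The layers concern |W0| and the tail hypothesis W0; the two agree off the null event where W0 <
   1. *)
have tailB j : (distribution P W0 (B j.+1) <= (h (b j))%:E)%E.
  rewrite -tail//.
  have mW1 : measurable [set q | 1 <= W0 q].
    rewrite (_ : [set q | _] = W0 @^-1` `[1, +oo[%classic).
      by rewrite -[X in measurable X]setTI; exact: measurable_funP.
    by apply/seteqP; split=> w /=; rewrite in_itv/= andbT.
  have W1C : P (~` [set q | 1 <= W0 q]) = 0%E.
    by rewrite probability_setC// W1 subee.
  have mW (A : set R) : measurable A -> measurable (W0 @^-1` A).
    by move=> mA; rewrite -[X in measurable X]setTI; exact: measurable_funP.
  rewrite /ccdf /distribution /pushforward -[leRHS]adde0 -W1C.
  set A1 := W0 @^-1` `]b j, +oo[%classic; set A2 := ~` _.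
  have mA1 : measurable A1 by exact: mW.
  have mA2 : measurable A2 by exact: measurableC.
  apply: (@le_trans _ _ (P (A1 `|` A2))); last exact: measureU2.
  apply: le_measure; rewrite ?inE.
  - exact: mW.
  - exact: measurableU.
  move=> q /= bq; have [q1|q1] := leP 1 (W0 q); [left|right].
    by rewrite /A1/= in_itv/= andbT -[W0 q]ger0_norm// (le_trans ler01).
  by apply/negP; rewrite -ltNge.
(* Layer 0 plus the geometric series with first term (2 t0)^r h(t0) and ratio [k]. *)
exists (t0 `^ r + (2 * t0) `^ r * h t0 / (1 - k)).
  by rewrite addr_gt0 ?powR_gt0// divr_gt0 ?subr_gt0// mulr_gt0 ?h0// powR_gt0// mulr_gt0.
exists c, B; split=> //.
- move=> w; have [wt|tw] := leP `|w| t0.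
    exists 0%N => //=; apply: ge0_ler_powR; rewrite ?nnegrE ?(ltW r0) ?(ltW t0gt0)//.
    by rewrite ge_max t01.
  have [n wn] : exists n, `|w| <= b n.
    exists (Num.bound `|w|); apply: ltW; apply: lt_le_trans (archi_boundP (normr_ge0 w)) _.
    apply: (@le_trans _ _ (2 ^+ Num.bound `|w|)); last first.
      by rewrite ler_peMr// exprn_ge0.
    by rewrite -natrX ler_nat ltnW// ltn_expl.
  have exP : exists n, `|w| <= b n by exists n.
  case: (ex_minnP exP) => -[|j] wj jmin.
    by move: tw; rewrite ltNge -[t0]mul1r -(expr0 2) wj.
  exists j.+1 => /=.
    by rewrite ltNge; apply/negP => /jmin; rewrite ltnn.
  apply: ge0_ler_powR; rewrite ?nnegrE ?(ltW r0) ?(ltW (b0 _))//.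
  by rewrite ge_max wj andbT (le_trans t01).
apply: nneseries_le_ub => [j|n]; first by rewrite mule_ge0// lee_fin.
pose D := (2 * t0) `^ r * h t0.
have D0 : 0 <= D by rewrite mulr_ge0 ?powR_ge0// ltW ?h0.
suff key : (\sum_(0 <= j < n.+1) (c j)%:E * distribution P W0 (B j) <=
   (t0 `^ r + D * (1 - k ^+ n) / (1 - k))%:E)%E.
  apply: le_trans (_ : _ <= \sum_(0 <= j < n.+1) (c j)%:E * distribution P W0 (B j))%E _.
    by rewrite big_nat_recr//= leeDl// mule_ge0// lee_fin.
  apply: le_trans key _; rewrite lee_fin lerD2l ler_pM2r ?invr_gt0 ?subr_gt0//.
  by rewrite -/D -[leRHS]mulr1 ler_wpM2l// gerBl exprn_ge0.
elim: n => [|n IH].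
  rewrite big_nat1/= expr0 subrr mulr0 mul0r addr0.
  by rewrite /distribution/= /pushforward preimage_setT probability_setT mule1.
rewrite big_nat_recr//=; apply: le_trans (leeD IH _) _.
  by apply: lee_wpmul2l (tailB n); rewrite lee_fin powR_ge0.
rewrite -EFinM -EFinD lee_fin -addrA lerD2l.
have cn : b n.+1 `^ r * h (b n) <= D * k ^+ n.
  have -> : b n.+1 `^ r = (2 * t0) `^ r * (2 `^ r) ^+ n.
    rewrite bS /b mulrCA (@powRM _ (2 ^+ n)) ?exprn_ge0 ?mulr_ge0 ?(ltW t0gt0)//.
    rewrite [LHS]mulrC -(@powR_mulrn _ 2)// powRAC powR_mulrn// powR_ge0//.
  rewrite -mulrA /D -[leRHS]mulrA ler_wpM2l ?powR_ge0//.
  by rewrite [leRHS]mulrC.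
apply: le_trans (lerD (lexx _) cn) _.
rewrite le_eqVlt; apply/orP; left; apply/eqP.
by rewrite exprS; field; rewrite subr_eq0 gt_eqF.
Qed.
End layers.

(** * Laplace transform and sums over paths *)

Section laplace.
Context {R : realType} {disp : measure_display} {T : measurableType disp}.
Variable P : probability T R.

(** Right-continuity of the distribution function at 0 gives eps > 0 with P(L <= eps) <= theta.
    Choosing kap with exp(-kap eps) = theta bounds the contribution of L > eps by theta as well. *)
Lemma laplace_layered_bound (L0 : {RV P >-> R}) (theta : R) :
  cdf L0 0 = 0%E -> 0 < theta -> theta < 1 ->
  exists2 kap : R, 0 < kap &
    layered_bound L0 (fun l => expR (- (kap * l))) (2 * theta).
Proof.
move=> cdf0 t0 t1.
have [eps e0 Leps] : exists2 eps : R, 0 < eps & (cdf L0 eps <= theta%:E)%E.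
  have cv : cdf L0 e @[e --> (0 : R)^'+] --> 0%E.
    by rewrite -cdf0; exact: cdf_right_continuous.
  have : \forall e \near 0^'+, (cdf L0 e < theta%:E)%E.
    apply: (cv [set y | (y < theta%:E)%E]).
    by apply: open_ereal_lt'; rewrite lte_fin.
  move=> /(filterI (nbhs_right_gt (0 : R)))/filter_ex[e [e0 el]].
  by exists e => //; exact: ltW.
pose kap := - ln theta / eps.
have kap0 : 0 < kap by rewrite divr_gt0// oppr_gt0 ln_lt0// t0.
have thetaE : theta = expR (- (kap * eps)).
  by rewrite /kap -mulrA mulVf ?gt_eqF// mulr1 opprK lnK.
exists kap => //.
(* From index 2 on, every layer is the null half-line: growing values cover exp(-kap l) for l <= 0,
   where it is unbounded, at no cost. *)
pose c j : R := match j with 0%N => 1 | 1%N => theta | j'.+2 => expR (kap * j'%:R) end.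
pose B j : set R := match j with
  0%N => `]-oo, eps]%classic | 1%N => setT | j'.+2 => `]-oo, 0]%classic end.
have c0 j : 0 <= c j by case: j => [|[|j]]//=; rewrite ?(ltW t0) ?expR_ge0.
exists c, B; split=> //.
- by case=> [|[|j]] /=.
- move=> l; have [l0|l0] := leP l 0.
    exists (Num.bound `|l|).+2; first by rewrite /= in_itv.
    rewrite /= ler_expR -mulrN ler_pM2l// -(ler0_norm l0).
    by rewrite ltW// archi_boundP.
  have [le|el] := leP l eps; [exists 0%N|exists 1%N] => //=.
  - by rewrite expR_le1 oppr_le0 mulr_ge0 ?ltW.
  - by rewrite thetaE ler_expR lerN2 ler_pM2l// ltW.
apply: nneseries_le_ub => [j|n]; first by rewrite mule_ge0// lee_fin.
have cB0 j : (0 <= (c j)%:E * distribution P L0 (B j))%E.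
  by rewrite mule_ge0// lee_fin.
apply: (@le_trans _ _ (\sum_(0 <= j < n.+2) (c j)%:E * distribution P L0 (B j))%E).
  rewrite 2?big_nat_recr//= -addeA. apply: leeDl.
  by apply: adde_ge0; [exact: cB0|exact: (cB0 n.+1)].
rewrite big_nat_recl// big_nat_recl// big1 ?adde0; last first.
  by move=> j _; rewrite /= -[X in (_ * X)%E]/(cdf L0 0) cdf0 mule0.
rewrite /= mul1e [X in (_ + _ * X)%E]probability_setT mule1.
by rewrite mulr_natl mulr2n EFinD leeD.
Qed.
End laplace.

Section path_sums.
Context {R : realFieldType} {V : eqType}.
Implicit Types (x y : V) (p : seq V).

(** Ordered pairs, unlike two-element sets, keep both endpoints available for the kernel. *)
Definition path_edges x p : seq (V * V) := zip (x :: p) p.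

Lemma path_edges_cons x y p :
  path_edges x (y :: p) = (x, y) :: path_edges y p.
Proof. by []. Qed.

Lemma pairmap_path_edges (T : Type) (f : V -> V -> T) x p :
  pairmap f x p = [seq f u.1 u.2 | u <- path_edges x p].
Proof. by elim: p x => //= y p IH x; rewrite IH. Qed.

Lemma size_path_edges x p : size (path_edges x p) = size p.
Proof. by rewrite size_zip/= minnE subSnn subn1. Qed.

(* Every inner vertex of the path lies on two of its edges. *)
Lemma prod_path_edges_le (g : V -> R) x p : (forall v, 1 <= g v) ->
  \prod_(u <- path_edges x p) (g u.1 * g u.2) <= \prod_(v <- x :: p) g v ^+ 2.
Proof.
move=> g1; have g0 v : 0 <= g v by apply: le_trans (g1 v).
have p0 y q : 0 <= \prod_(u <- path_edges y q) (g u.1 * g u.2).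
  by apply: prodr_ge0 => u _; rewrite mulr_ge0.
apply: (@le_trans _ _ (g x * \prod_(u <- path_edges x p) (g u.1 * g u.2))).
  by rewrite ler_peMl.
elim: p x => [|y p IH] x.
  by rewrite [path_edges _ _]/= big_cons !big_nil !mulr1 expr2 ler_peMl.
rewrite path_edges_cons !big_cons.
rewrite mulrA mulrA -expr2 -mulrA ler_wpM2l ?sqr_ge0//.
by apply: le_trans (IH y) _; rewrite big_cons.
Qed.

(** A catalogue that contains any given finite list of paths and opens its sums to induction on the
    length. *)
Fixpoint words (vs : seq V) (n : nat) : seq (seq V) :=
  if n is n'.+1 then [::] :: [seq y :: p | y <- vs, p <- words vs n'] else [:: [::]].

Lemma mem_words vs n p : (size p <= n)%N -> {subset p <= vs} -> p \in words vs n.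
Proof.
elim: n p => [|n IH] [|y p] // pn pvs.
rewrite /= in_cons /=; apply/allpairsP; exists (y, p); split=> //=.
  by apply: pvs; rewrite mem_head.
by apply: IH => // v vp; apply: pvs; rewrite inE vp orbT.
Qed.

(** Splitting off the first step gives s_(n+1) <= 1 + s_n / 2, and 2 is the fixed point of this
    recursion. *)
Lemma sum_path_prod_le2 (q : V -> V -> R) :
  (forall x y, 0 <= q x y) ->
  (forall x vs, uniq vs -> \sum_(y <- vs) q x y <= 2^-1) ->
  forall x (ps : seq (seq V)), uniq ps ->
  \sum_(p <- ps) \prod_(u <- path_edges x p) q u.1 u.2 <= 2.
Proof.
move=> q0 qsum x ps ups.
have p0 y p : 0 <= \prod_(u <- path_edges y p) q u.1 u.2.
  by apply: prodr_ge0.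
pose vs := undup (flatten ps); pose n := \max_(p <- ps) size p.
apply: (@le_trans _ _ (\sum_(p <- words vs n) \prod_(u <- path_edges x p) q u.1 u.2)).
  apply: ler_sum_uniq_subset => // p pps; apply: mem_words.
    exact: (leq_bigmax_seq (F := size)).
  by move=> v vp; rewrite mem_undup; apply/flattenP; exists p.
elim: n x => [|n IH] x /=.
  by rewrite big_seq1 big_nil ler1n.
rewrite big_cons big_nil big_allpairs_dep.
apply: (@le_trans _ _ (1 + \sum_(y <- vs) q x y * 2)).
  rewrite lerD2l; apply: ler_sum => y _.
  under eq_bigr do rewrite path_edges_cons big_cons.
  rewrite -mulr_sumr; apply: ler_wpM2l; [exact: q0|exact: IH].
rewrite -mulr_suml (@le_trans _ _ (1 + 2^-1 * 2))//; last first.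
  by rewrite mulVf ?pnatr_eq0.
by rewrite lerD2l ler_wpM2r// qsum// undup_uniq.
Qed.

End path_sums.

(** * Paths in the percolation model *)

Lemma sigma_gen_bigcap_seq (T : pointedType) (G : set (set T)) (I : choiceType)
    (s : seq I) (F : I -> set T) :
  (forall i, i \in s -> <<s G >> (F i)) ->
  <<s G >> (\bigcap_(i in [set` s]) F i).
Proof.
move=> sF; rewrite bigcap_seq big_seq.
exact: (@bigsetI_measurable _ (g_sigma_algebraType G)).
Qed.

Section paths_in_SFP.
Context {R : realType} {d : nat}.
Context {disp : measure_display} {T : measurableType disp}.
Variable P : probability T R.
Variables (W : 'rV[int]_d -> {RV P >-> R})
          (E : {fset 'rV[int]_d} -> set T)
          (L : {fset 'rV[int]_d} -> {RV P >-> R}).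
Variables (alpha lambda : R) (dispQ : measure_display)
  (TQ : measurableType dispQ) (Q : probability TQ R) (W0 L0 : {RV Q >-> R}).
Hypothesis sfp : is_SFP W E L alpha lambda W0 L0.
Implicit Types (x : 'rV[int]_d) (p : seq 'rV[int]_d).

Lemma path_edges_neq x p (u : 'rV[int]_d * 'rV[int]_d) :
  uniq (x :: p) -> u \in path_edges x p -> u.1 != u.2.
Proof.
elim: p x => [|y p IH] x //; rewrite path_edges_cons cons_uniq => /andP[xNp up].
rewrite in_cons => /predU1P[->/=|]; last exact: IH.
by apply: contraNneq xNp => ->; rewrite mem_head.
Qed.

Lemma path_edges_mem (V : eqType) (x : V) (p : seq V) (u : V * V) :
  u \in path_edges x p -> (u.1 \in x :: p) && (u.2 \in x :: p).
Proof.
elim: p x => [|y p IH] x //; rewrite path_edges_cons in_cons => /predU1P[->/=|/IH].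
  by rewrite !inE !eqxx orbT.
by move=> /andP[]; rewrite !inE => -> ->; rewrite !orbT.
Qed.

(** The starting vertex is never revisited, so it lies on the first edge only. *)
Lemma path_edges_fset_uniq x p : uniq (x :: p) ->
  uniq [seq [fset u.1; u.2]%fset | u <- path_edges x p].
Proof.
elim: p x => [|y p IH] x //; rewrite path_edges_cons cons_uniq => /andP[xNp up].
rewrite map_cons cons_uniq IH// andbT.
apply/mapP => -[u /path_edges_mem/andP[u1 u2]] /fsetP/(_ x).
rewrite !inE eqxx/= => /esym/orP[]/eqP xu; move: xNp.
  by rewrite xu u1.
by rewrite xu u2.
Qed.

Definition path_event x p : set T :=
  \bigcap_(u in [set` path_edges x p]) E [fset u.1; u.2]%fset.

Lemma vertex_pair_path_edge x p (u : 'rV[int]_d * 'rV[int]_d) :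
  uniq (x :: p) -> u \in path_edges x p -> vertex_pair [fset u.1; u.2]%fset.
Proof.
by move=> uxp ue; rewrite /vertex_pair/= cardfs2 (path_edges_neq uxp ue).
Qed.

Lemma sigma_WE_path_event x p : uniq (x :: p) -> sigma_WE W E (path_event x p).
Proof.
move=> uxp; apply: sigma_gen_bigcap_seq => u ue.
apply: sub_gen_smallest; right; exists [fset u.1; u.2]%fset => //.
exact: vertex_pair_path_edge ue.
Qed.

Lemma measurable_path_event x p : uniq (x :: p) -> measurable (path_event x p).
Proof.
move=> uxp; rewrite /path_event bigcap_seq big_seq.
apply: bigsetI_measurable => u ue; apply: (sfp_edge_measurable sfp).
exact: vertex_pair_path_edge ue.
Qed.

(** The path event lies in [sigma_WE] and the weights are in [sigma_L], so the event factors out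
    first; the edges are distinct, so their weights factor next. *)
Lemma indep_event_edge_weights x p : uniq (x :: p) ->
  indep_event L (path_event x p) [seq [fset u.1; u.2]%fset | u <- path_edges x p].
Proof.
move=> uxp B mB; set s := [seq _ | _ <- _].
have us : uniq s by exact: path_edges_fset_uniq.
have sD e : e \in s -> vertex_pair e.
  by move=> /mapP[u ue ->]; exact: vertex_pair_path_edge ue.
rewrite setIC (sfp_edge_weight_indep_graph sfp); last exact: sigma_WE_path_event.
  by rewrite (sfp_edge_weight_indep sfp)// muleC.
apply: sigma_gen_bigcap_seq => e es; apply: sub_gen_smallest.
by exists e, (B e); split=> //; exact: sD.
Qed.

Lemma indep_event_vertex_weights x p : uniq (x :: p) ->
  indep_event W setT (x :: p).
Proof.
move=> uxp B mB; rewrite setTI probability_setT mul1e.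
exact: (sfp_vertex_weight_indep sfp).
Qed.

(** The conditional probability given the weights is integrated. A path uses a vertex at most twice,
    so each weight enters with power at most 2s, and independence gives a factor [m] per vertex. *)
Lemma probability_path_event_le (s beta m : R) x p :
  0 < lambda -> 0 < beta -> 0 < s -> s <= 1 -> alpha * s = beta * d%:R ->
  0 <= m -> Q [set q | 1 <= W0 q] = 1%E ->
  layered_bound W0 (fun w => Num.max 1 `|w| `^ (s + s)) m ->
  uniq (x :: p) ->
  (P (path_event x p) <= (m * \prod_(u <- path_edges x p)
     (m * ((2 `^ alpha * (1 + lambda)) `^ s *
      lattice_kernel beta (u.1 - u.2))))%:E)%E.
Proof.
move=> l0 b0 s0 s1 sE m0 W1 [c [B [c0 mB cov cB]]] uxp.
set K := (2 `^ alpha * (1 + lambda)) `^ s.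
pose v (w : R) := Num.max 1 `|w|.
have v1 w : 1 <= v w by rewrite le_max lexx.
have [_ /integrableP[mg _]] := sfp_edges sfp (s := path_edges x p)
  (fun u => path_edges_neq uxp) (path_edges_fset_uniq uxp).
(* This event has probability 1 and lies in [sigma_W], so the conditional probability may be
   integrated over it; on it every [conn_prob] along the path is nonnegative. *)
pose Om := \bigcap_(y in [set` x :: p]) (W y @^-1` `[1, +oo[%classic).
have sOm : sigma_W W Om.
  apply: sigma_gen_bigcap_seq => y _; apply: sub_gen_smallest.
  by exists y, `[1, +oo[%classic; split.
have mOm : measurable Om.
  rewrite /Om bigcap_seq; apply: bigsetI_measurable => y _.
  exact: measurable_RV_preimage.
have POm : P Om = 1%E.
  rewrite (sfp_vertex_weight_indep sfp)// big1// => y _.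
  have := sfp_vertex_weight_law sfp y (measurable_itv `[1, +oo[).
  rewrite /distribution/= /pushforward => ->; rewrite -W1; congr (Q _).
  by apply/seteqP; split=> q /=; rewrite in_itv/= andbT.
have W1w w y : Om w -> y \in x :: p -> 1 <= W y w.
  by move=> Omw yxp; have := Omw _ yxp; rewrite /= in_itv/= andbT.
have mG := measurable_path_event uxp.
move=> /(_ Om sOm); rewrite -/(path_event x p) => intG.
have PG : (P (path_event x p) <= P (Om `&` path_event x p))%E.
  rewrite -[leRHS]adde0 -[X in (_ + X)%E](_ : P (~` Om) = 0%E); last first.
    by rewrite probability_setC// POm subee.
  set A1 := Om `&` _; have mA1 : measurable A1 by exact: measurableI.
  have mA2 : measurable (~` Om) by exact: measurableC.
  apply: (@le_trans _ _ (P (A1 `|` ~` Om))); last exact: measureU2.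
  apply: le_measure; rewrite ?inE//; first exact: measurableU.
  by move=> w Gw; have [Omw|] := pselect (Om w); [left|right].
apply: le_trans PG _; rewrite -intG.
pose C := \prod_(u <- path_edges x p) (K * lattice_kernel beta (u.1 - u.2)).
have C0 : 0 <= C.
  by apply: prodr_ge0 => u _; rewrite mulr_ge0 ?powR_ge0 ?lattice_kernel_ge0.
have mf : measurable_fun setT (fun w : R => v w `^ (s + s)).
  apply: (measurableT_comp (measurable_powR _)).
  by apply: measurable_maxr => //; exact: measurable_normr.
have mF : measurable_fun setT (fun w => \prod_(y <- x :: p) v (W y w) `^ (s + s)).
  apply: measurable_prod => y _.
  by apply: (measurableT_comp mf); exact: measurable_funP.
pose h w := (\prod_(y <- x :: p) v (W y w) `^ (s + s))%:E.
have h0 w : (0 <= h w)%E by rewrite lee_fin prodr_ge0// => y _; exact: powR_ge0.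
have mh : measurable_fun setT h by exact/measurable_EFinP.
have conn0 w (u : 'rV[int]_d * 'rV[int]_d) : Om w -> u \in path_edges x p ->
    0 <= conn_prob alpha lambda u.1 u.2 (W u.1 w) (W u.2 w).
  move=> Omw /path_edges_mem/andP[u1 u2].
  rewrite /conn_prob; case: ifP => // _.
  rewrite subr_ge0 expR_le1 oppr_le0 divr_ge0 ?powR_ge0//.
  rewrite mulr_ge0 ?(le_trans ler01 (W1w _ _ Omw u2))//.
  by rewrite mulr_ge0 ?(le_trans ler01 (W1w _ _ Omw u1))// ltW.
apply: (@le_trans _ _ (\int[P]_(w in Om) (C%:E * h w))%E).
  apply: ge0_le_integral => //.
  - move=> w Omw; rewrite lee_fin big_seq prodr_ge0// => u ue.
    exact: conn0.
  - exact: measurable_funTS.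
  - by apply: measurable_funTS; exact: measurable_funeM.
  move=> w Omw; rewrite -EFinM lee_fin.
  apply: (@le_trans _ _ (\prod_(u <- path_edges x p)
    (K * lattice_kernel beta (u.1 - u.2) * (v (W u.1 w) `^ s * v (W u.2 w) `^ s)))).
    rewrite big_seq [leRHS]big_seq; apply: ler_prod => u ue.
    rewrite conn_prob_le ?(path_edges_neq uxp ue)// andbT.
    exact: conn0.
  rewrite big_split/= ler_wpM2l//.
  have g1 y : 1 <= v (W y w) `^ s.
    by rewrite -[leLHS](powRr0 (v (W y w))) ler_powR// ltW.
  apply: le_trans (prod_path_edges_le x p g1) _.
  apply: ler_prod => y _; rewrite sqr_ge0/= powRD ?expr2//.
  by rewrite (gt_eqF (addr_gt0 s0 s0)).
apply: (@le_trans _ _ (\int[P]_w (C%:E * h w))%E).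
  apply: ge0_subset_integral => //; first exact: measurable_funeM.
  by move=> w _; rewrite mule_ge0.
rewrite ge0_integralZl//.
(* Of the |p| + 1 factors [m], one stays in front and the others are shared out among the |p|
   edges. *)
rewrite big_split/= big_const_seq count_predT iter_mulr_1 size_path_edges.
rewrite mulrA -exprS mulrC EFinM lee_wpmul2l ?lee_fin//.
rewrite -[leRHS]mul1e -(probability_setT P).
apply: (integral_prod_indep_le (f := fun w => v w `^ (s + s)) (c := c) (B := B)) => //.
- by move=> w; exact: powR_ge0.
- move=> y _; apply: le_trans cB; apply: lee_nneseries => j.
    by move=> _ _; rewrite mule_ge0// lee_fin.
  by move=> _; rewrite -(sfp_vertex_weight_law sfp y (mB j)).
exact: indep_event_vertex_weights.
Qed.

(** The value 0 on lists that repeat a vertex lets sums range over all lists, a countable type. *)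
Definition path_term (kap : R) x p (w : T) : R :=
  if uniq (x :: p)
  then \1_(path_event x p) w * expR (- (kap * path_weight L w x p)) else 0.

Lemma path_term_ge0 kap x p w : 0 <= path_term kap x p w.
Proof. by rewrite /path_term; case: ifP => // _; rewrite mulr_ge0// expR_ge0. Qed.

Lemma path_term_expE kap x p w :
  expR (- (kap * path_weight L w x p)) =
  \prod_(e <- [seq [fset u.1; u.2]%fset | u <- path_edges x p])
    expR (- (kap * L e w)).
Proof.
by rewrite /path_weight pairmap_path_edges mulr_sumr -sumrN expR_sum.
Qed.

Lemma measurable_path_term kap x p : measurable_fun setT (path_term kap x p).
Proof.
rewrite /path_term; case uxp : (uniq (x :: p)); last exact: measurable_cst.
apply: measurable_funM; first by apply: measurable_indic; exact: measurable_path_event.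
under eq_fun do rewrite path_term_expE.
apply: measurable_prod => e _; apply: measurableT_comp => //.
apply: measurableT_comp => //; exact: measurable_funM.
Qed.

Lemma integral_path_term_le (kap mu : R) x p : 0 <= mu ->
  layered_bound L0 (fun l => expR (- (kap * l))) mu -> uniq (x :: p) ->
  (\int[P]_w (path_term kap x p w)%:E <=
   P (path_event x p) * (mu ^+ size p)%:E)%E.
Proof.
move=> mu0 [c [B [c0 mB cov cB]]] uxp.
have mG := measurable_path_event uxp.
have -> : (\int[P]_w (path_term kap x p w)%:E =
    \int[P]_(w in path_event x p)
      (\prod_(e <- [seq [fset u.1; u.2]%fset | u <- path_edges x p])
         expR (- (kap * L e w)))%:E)%E.
  rewrite [RHS]integral_mkcond; apply: eq_integral => w _.
  rewrite /path_term uxp /patch indicE -path_term_expE.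
  by case: ifP => _; rewrite ?mul1r ?mul0r.
rewrite -(size_path_edges x) -(size_map (fun u => [fset u.1; u.2]%fset)).
apply: (integral_prod_indep_le (f := fun l => expR (- (kap * l))) (c := c) (B := B)) => //.
- by apply: measurableT_comp => //; exact: measurableT_comp.
- move=> _ /mapP[u ue ->]; apply: le_trans cB; apply: lee_nneseries => j.
    by move=> _ _; rewrite mule_ge0// lee_fin.
  move=> _.
  by rewrite -(sfp_edge_weight_law sfp (vertex_pair_path_edge uxp ue) (mB j)).
- exact: path_edges_fset_uniq.
exact: indep_event_edge_weights.
Qed.
End paths_in_SFP.

(** * Almost sure finiteness of countable sums *)

Section countable_sums.
Context {R : realType} {disp : measure_display} {T : measurableType disp}.
Variable P : probability T R.

(** The sum over an enumeration of [J] has integral at most [M], hence is finite almost everywhere,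
    and its value bounds every finite subsum. *)
Lemma ae_summable_of_integral (J : countType) (F : J -> T -> R) (b : J -> R) (M : R) :
  (forall i w, 0 <= F i w) -> (forall i, measurable_fun setT (F i)) ->
  (forall i, (\int[P]_w (F i w)%:E <= (b i)%:E)%E) ->
  (forall s : seq J, uniq s -> \sum_(i <- s) b i <= M) ->
  {ae P, forall w, exists S : R,
    forall s : seq J, uniq s -> \sum_(i <- s) F i w <= S}.
Proof.
move=> F0 mF Fb bM.
(* Numbers that encode no element of [J] contribute 0. *)
pose f n w : R := if choice.pickle_inv n is Some i then F i w else 0.
have f0 n w : 0 <= f n w by rewrite /f; case: choice.pickle_inv.
have mf n : measurable_fun setT (f n).
  by rewrite /f; case: choice.pickle_inv => [i|]; [exact: mF|exact: measurable_cst].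
have mfE n : measurable_fun setT (EFin \o f n) by exact/measurable_EFinP.
pose g w := (\sum_(0 <= n <oo) (f n w)%:E)%E.
have g0 w : (0 <= g w)%E by apply: nneseries_ge0 => n _ _; rewrite lee_fin.
have mg : measurable_fun setT g.
  apply: ge0_emeasurable_sum => [k w _ _|k _]; first by rewrite lee_fin.
  exact: mfE.
have intg : (\int[P]_w g w <= M%:E)%E.
  rewrite integral_nneseries//; last by move=> n w _; rewrite lee_fin.
  apply: nneseries_le_ub => [n|N].
    by apply: integral_ge0 => w _; rewrite lee_fin.
  have : uniq (pmap choice.pickle_inv (iota 0 N) : seq J).
    by apply: (pmap_uniq (@choice.pickle_invK J)); exact: iota_uniq.
  move=> /bM bN; apply: le_trans (_ : (_ <=
      (\sum_(i <- pmap choice.pickle_inv (iota 0 N)) b i)%:E)%E) _;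
    last by rewrite lee_fin.
  rewrite /index_iota subn0; elim: (iota 0 N) => [|n s IH] /=.
    by rewrite !big_nil.
  rewrite big_cons /f; case E : (choice.pickle_inv n) => [i|] /=.
    by rewrite big_cons EFinD leeD.
  by rewrite integral0 add0e.
have ig : P.-integrable setT g.
  apply/integrableP; split=> //.
  under eq_integral do rewrite gee0_abs//.
  exact: le_lt_trans intg (ltry _).
have := integrable_ae measurableT ig; apply: filterS => w /(_ I) gfin.
exists (fine (g w)) => s us; rewrite -lee_fin fineK//.
pose N := (\max_(i <- s) choice.pickle i)%N.+1.
have fE0 n : (0 <= (f n w)%:E)%E by rewrite lee_fin.
apply: le_trans (nneseries_lim_ge N (fun n _ _ => fE0 n)).
rewrite sumEFin lee_fin.
rewrite (eq_bigr (fun i => f (choice.pickle i) w)); last first.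
  by move=> i _; rewrite /f choice.pickleK_inv.
rewrite -(big_map choice.pickle predT (fun n => f n w)).
apply: ler_sum_uniq_subset => //.
  by rewrite map_inj_uniq//; exact: (pcan_inj (@choice.pickleK J)).
move=> _ /mapP[i si ->]; rewrite mem_index_iota /= ltnS.
exact: (leq_bigmax_seq (F := choice.pickle)).
Qed.
End countable_sums.

(** * Ball growth *)

(** A total function, with the junk value [u0] from [n] on, can be composed with maps over
    [iota 0 n]. *)
Lemma card_II_le (U : choiceType) (u0 : U) (n : nat) (B : set U) :
  (`I_n #<= B)%card -> exists g : nat -> U,
    (forall i, (i < n)%N -> B (g i)) /\
    (forall i j, (i < n)%N -> (j < n)%N -> g i = g j -> i = j).
Proof.
move=> /card_leP[f].
pose g i : U := if pselect (`I_n i) is left ni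
  then val (f (SigSub (mem_set ni))) else u0.
exists g; split=> [i ni|i j ni nj]; rewrite /g.
  by case: pselect => // ni'; exact: set_valP.
case: pselect => // ni'; case: pselect => // nj' /val_inj/inj.
by rewrite !inE => /(_ Logic.I Logic.I) [].
Qed.

Section ball_growth.
Context {R : realType} {d : nat}.
Context {disp : measure_display} {T : measurableType disp}.
Variable P : probability T R.
Variables (E : {fset 'rV[int]_d} -> set T)
          (L : {fset 'rV[int]_d} -> {RV P >-> R}).
Implicit Types (x y : 'rV[int]_d) (p : seq 'rV[int]_d).

Lemma path_adjacent_event (w : T) x p :
  path (Defs.adjacent E w) x p -> path_event E x p w.
Proof.
move=> + u /=; elim: p x => [|y p IH] x //= /andP[/andP[_ /asboolP Exy] py].
by rewrite in_cons => /predU1P[->//|]; exact: IH.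
Qed.

(** The infimum that defines the distance need not be attained, hence the slack 1. *)
Lemma path_of_ball_L (w : T) x y (t : R) : ball_L E L w x t y ->
  exists2 p, is_path E w x y p & path_weight L w x p < t + 1.
Proof.
move=> yt; have : (dist_L E L w x y < (t + 1)%:E)%E.
  by apply: le_lt_trans yt _; rewrite lte_fin ltrDl.
by move=> /ereal_inf_lt[_ [p xyp <-]]; rewrite lte_fin => pt; exists p.
Qed.

(** Distinct points of the ball are ends of distinct paths, each contributing at least exp(-kap (t +
    1)) to the sum. *)
Lemma card_ball_L_le (kap S : R) (w : T) x (n : nat) (t : R) : 0 < kap ->
  (forall ps : seq (seq 'rV[int]_d), uniq ps ->
     \sum_(p <- ps) path_term E L kap x p w <= S) ->
  (`I_n #<= ball_L E L w x t)%card -> n%:R <= S * expR (kap * (t + 1)).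
Proof.
move=> kap0 sumS /(card_II_le x)[f [fB f_inj]].
have /choice[pf pfP] : forall i, exists p, (i < n)%N ->
    is_path E w x (f i) p /\ path_weight L w x p < t + 1.
  move=> i; have [ni|ni] := ltnP i n; last by exists [::].
  have [p pP pw] : exists2 p, is_path E w x (f i) p & path_weight L w x p < t + 1.
    by apply: path_of_ball_L; exact: fB.
  by exists p.
have ups : uniq [seq pf i | i <- iota 0 n].
  rewrite map_inj_in_uniq ?iota_uniq// => i j.
  rewrite !mem_iota /= !add0n => ni nj pij.
  have [[_ li _] _] := pfP _ ni; have [[_ lj _] _] := pfP _ nj.
  by apply: f_inj => //; rewrite -li -lj pij.
have := sumS _ ups; rewrite big_map => Sle.
have : \sum_(i <- iota 0 n) expR (- (kap * (t + 1))) <= S.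
  apply: le_trans Sle; rewrite big_seq [leRHS]big_seq; apply: ler_sum => i.
  rewrite mem_iota /= add0n => /pfP[[pa _ up] pw].
  rewrite /path_term up indicE mem_set ?mul1r; last exact: path_adjacent_event.
  by rewrite ler_expR lerN2 ler_pM2l// ltW.
rewrite big_const_seq count_predT size_iota iter_addr_0 expRN -[_ *+ n]mulr_natl.
by rewrite ler_pdivrMr ?expR_gt0.
Qed.

End ball_growth.

(** * Choice of the constants and the three conclusions *)

Theorem corollary1p9 (R : realType) (d : nat) (alpha lambda tau : R)
    (dispQ : measure_display) (TQ : measurableType dispQ)
    (Q : probability TQ R) (W0 L0 : {RV Q >-> R}) (ell : R -> R)
    (disp : measure_display) (T : measurableType disp) (P : probability T R)
    (W : 'rV[int]_d -> {RV P >-> R})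
    (E : {fset 'rV[int]_d} -> set T)
    (L : {fset 'rV[int]_d} -> {RV P >-> R})
    (d_ge1 : (1 <= d)%N) (alpha_gt : d%:R < alpha) (lambda_gt0 : 0 < lambda)
    (tau_gt1 : 1 < tau)
    (W0_ge1 : Q [set q | 1 <= W0 q] = 1%E)
    (ell_sv : slowly_varying ell)
    (W0_tail : forall t : R, 0 < t ->
       ccdf W0 t = (ell t / t `^ (tau - 1))%:E)
    (L0_ge0 : Q [set q | 0 <= L0 q] = 1%E)
    (sfp : is_SFP W E L alpha lambda W0 L0)
    (gamma_gt2 : 2 < alpha * (tau - 1) / d%:R)
    (FL0 : cdf L0 0 = 0%E) (x : 'rV[int]_d) :
  [/\ exists2 c : R, 0 < c &
        {ae P, forall w, \forall n \near \oo,
          ((c * ln n%:R)%:E <= tau_n E L w x n)%E},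
      {ae P, forall w, tau_n E L w x n @[n --> \oo] --> (+oo)%E}
    & {ae P, forall w, ~ explosive E L w x}].
Proof.
have d0 : 0 < d%:R :> R by rewrite ltr0n.
have a0 : 0 < alpha by exact: lt_trans alpha_gt.
(* The interval from d/alpha to min(1, (tau - 1)/2) is nonempty because alpha > d and gamma > 2; [s]
   is its midpoint. *)
have [s [s0 s1 ds str]] : exists s : R,
    [/\ 0 < s, s <= 1, d%:R / alpha < s & s + s < tau - 1].
  have da1 : d%:R / alpha < 1 by rewrite ltr_pdivrMr// mul1r.
  have da0 : 0 < d%:R / alpha by exact: divr_gt0.
  have dat : d%:R / alpha < (tau - 1) / 2.
    move: gamma_gt2; rewrite ltr_pdivlMr// => dat.
    by rewrite ltr_pdivrMr// mulrAC ltr_pdivlMr// mulrC (mulrC _ alpha).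
  have [st|ts] := leP 1 ((tau - 1) / 2).
    by exists ((d%:R / alpha + 1) / 2); split; lra.
  by exists ((d%:R / alpha + (tau - 1) / 2) / 2); split; lra.
pose beta := alpha * s / d%:R.
have beta1 : 1 < beta by rewrite ltr_pdivlMr// mul1r mulrC -ltr_pdivrMr.
have sE : alpha * s = beta * d%:R by rewrite mulfVK ?gt_eqF.
have beta0 : 0 < beta by exact: lt_trans beta1.
have [m m0 mW] : exists2 m : R, 0 < m &
    layered_bound W0 (fun w => Num.max 1 `|w| `^ (s + s)) m.
  by apply: (powR_moment_layered_bound W0_ge1 ell_sv W0_tail) => //; lra.
have [C C0 sumC] := @lattice_sum_bounded R d beta beta1.
pose K : R := (2 `^ alpha * (1 + lambda)) `^ s.
have K0 : 0 <= K by exact: powR_ge0.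
have mKC0 : 0 <= m * (K * C) by rewrite !mulr_ge0// ltW.
(* With M = m K C, 2 theta M = 2M / (4M + 2) <= 1/2, and the summand 2 keeps theta below 1. *)
pose theta : R := (4 * (m * (K * C)) + 2)^-1.
have theta0 : 0 < theta by rewrite invr_gt0; lra.
have theta1 : theta < 1 by rewrite invf_lt1; lra.
have thetaC : 2 * theta * (m * (K * C)) <= 2^-1.
  rewrite /theta mulrAC ler_pdivrMr; lra.
have [kap kap0 mL] := laplace_layered_bound FL0 theta0 theta1.
(* Cost of one step: the bound for the presence of the edge times the bound 2 theta for its Laplace
   factor. *)
pose q (y z : 'rV[int]_d) : R :=
  2 * theta * (m * (K * lattice_kernel beta (y - z))).
have q0 y z : 0 <= q y z.
  by rewrite !mulr_ge0 ?lattice_kernel_ge0// ltW.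
have sumq y vs : uniq vs -> \sum_(z <- vs) q y z <= 2^-1.
  move=> uvs; rewrite -!mulr_sumr; apply: le_trans thetaC.
  by rewrite !ler_wpM2l ?sumC ?mulr_ge0// ltW.
have growth : {ae P, forall w, exists2 S : R, 0 < S & forall n t,
    (`I_n #<= ball_L E L w x t)%card -> n%:R <= S * expR (kap * (t + 1))}.
  have b0 p : 0 <= m * \prod_(u <- path_edges x p) q u.1 u.2.
    by rewrite mulr_ge0 ?(ltW m0)// prodr_ge0.
  have int_le p : (\int[P]_w (path_term E L kap x p w)%:E <=
      (m * \prod_(u <- path_edges x p) q u.1 u.2)%:E)%E.
    case uxp : (uniq (x :: p)); last first.
      rewrite /path_term uxp integral0; exact: b0.
    apply: le_trans (integral_path_term_le sfp _ mL uxp) _.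
      by rewrite mulr_ge0// ltW.
    have Pp := probability_path_event_le sfp lambda_gt0 beta0 s0 s1 sE
      (ltW m0) W0_ge1 mW uxp.
    apply: le_trans (lee_wpmul2r _ Pp) _.
      by rewrite lee_fin exprn_ge0// mulr_ge0// ltW.
    rewrite -EFinM lee_fin -mulrA ler_wpM2l ?(ltW m0)//.
    have -> : (2 * theta) ^+ size p = \prod_(u <- path_edges x p) (2 * theta).
      by rewrite big_const_seq count_predT iter_mulr_1 size_path_edges.
    by rewrite -big_split/=; under eq_bigr do rewrite mulrC.
  have sum_le ps : uniq ps ->
      \sum_(p <- ps) m * \prod_(u <- path_edges x p) q u.1 u.2 <= m * 2.
    move=> ups; rewrite -mulr_sumr ler_wpM2l ?(ltW m0)//.
    exact: sum_path_prod_le2.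
  have := ae_summable_of_integral (path_term_ge0 E L kap x)
    (measurable_path_term sfp kap x) int_le sum_le.
  (* The maximum with 1 makes the constant positive, so that its logarithm can be taken later. *)
  apply: filterS => w [S sumS]; exists (Num.max 1 S) => [|n t cn].
    by rewrite lt_max ltr01.
  apply: le_trans (card_ball_L_le kap0 sumS cn) _.
  by rewrite ler_wpM2r ?expR_ge0// le_max lexx orbT.
(* Logarithms in the growth bound give kap t >= ln n - ln S - kap; half of ln n absorbs the last two
   terms for large [n], whence the 2. *)
pose c := (2 * kap)^-1.
have c0 : 0 < c by rewrite invr_gt0 mulr_gt0.
have log_growth : {ae P, forall w, \forall n \near \oo,
    ((c * ln n%:R)%:E <= tau_n E L w x n)%E}.
  apply: filterS growth => w [S S0 Sn].
  exists (Num.bound (expR (2 * (ln S + kap)))) => // n /= nbig.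
  have en : expR (2 * (ln S + kap)) < n%:R.
    apply: lt_le_trans (archi_boundP (expR_ge0 _)) _.
    by rewrite ler_nat.
  have n0 : 0 < n%:R :> R by apply: le_lt_trans en; exact: expR_ge0.
  have lnn : 2 * (ln S + kap) < ln n%:R.
    by rewrite -[ltLHS]expRK ltr_ln// ?posrE ?expR_gt0.
  apply: le_ereal_inf_tmp => _ [t /= cn <-]; rewrite lee_fin.
  have := Sn _ _ cn; rewrite -ler_ln ?posrE ?mulr_gt0 ?expR_gt0//.
  rewrite lnM ?posrE ?expR_gt0// expRK => lnt.
  rewrite /c mulrC ler_pdivrMr ?mulr_gt0//; nra.
split; first by exists c.
- apply: filterS log_growth => w wn; apply/cvgeyPge => a.
  have na : \forall n \near \oo, a <= c * ln n%:R.
    exists (Num.bound (expR (a / c))) => // n /= nbig.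
    have en : expR (a / c) < n%:R.
      apply: lt_le_trans (archi_boundP (expR_ge0 _)) _.
      by rewrite ler_nat.
    have n0 : 0 < n%:R :> R by apply: le_lt_trans en; exact: expR_ge0.
    rewrite mulrC -ler_pdivrMr// -[leLHS]expRK ler_ln ?posrE ?expR_gt0//.
    exact: ltW.
  by near=> n; apply: (@le_trans _ _ (c * ln n%:R)%:E);
    [rewrite lee_fin; near: n|near: n].
apply: filterS growth => w [S S0 Sn] [t inft].
(* An infinite ball has at least [n] elements for every [n]; this one exceeds the growth bound. *)
pose n := Num.bound (S * expR (kap * (t + 1))).
have : n%:R <= S * expR (kap * (t + 1)).
  apply: Sn; move/infiniteP: inft; apply: card_le_trans; exact: subset_card_le.
by rewrite leNgt archi_boundP// mulr_ge0 ?expR_ge0// ltW.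
Unshelve. all: by end_near. Qed.
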